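(* In the Brownian-with-drift setting of the context, let $b_1^*,c_1,\mathcal D_1,z_1$ be as defined there, suppose $(\mathcal L-q)H(v_1;b_1^* )>0$ for some $v_1>b_1^*$, and let $b_2^*=\inf\mathcal D_1$, $b_3^*=z_1(b_2^* )$. Assume that there exists $\epsilon_1>0$ such that $$\partial_zF(v,v+;b_1^* )=(\mathcal L-q)H(v;b_1^* )<0\quad\text{for } v\in(b_2^*,b_2^*+\epsilon_1).$$ Then $$b_1^*<b_2^*<b_3^*,\qquad b_2^*<c_1,\qquad\text{and}\qquad F(b_2^*,b_2^*;b_1^* )=F(b_2^*,b_3^*;b_1^* ).$$
   Context: Fix $\mu\in\mathbb R$, $\sigma>0$, $q>0$, and let $\mathcal Lf=\frac{\sigma^2}2f''+\mu f'$ (generator of $X_t=x+\mu t+\sigma B_t$). With $s=\sqrt{\mu^2+2q\sigma^2}$, $\Phi(q)=(s-\mu)/\sigma^2$, $\zeta_1=(s+\mu)/\sigma^2$, let $W(x)=\frac1s(e^{\Phi(q)x}-e^{-\zeta_1x})$ for $x\ge0$. Let $g:(0,\infty)\to(0,\infty)$ be twice continuously differentiable, extending continuously to $0$, with $g(z)=o(e^{\Phi(q)z})$ as $z\to\infty$. Let $F(u)=g(u)/W'(u)$, $u\ge0$, and $b_1^*=\sup\{u\ge0:F(u)\ge F(x)\ \forall x\ge0\}$ (finite). Define $$H(x;b_1^* )=\int_{b_1^*}^xg(y)dy+g(b_1^* )\frac{W(b_1^* )}{W'(b_1^* )},\quad\text{so }(\mathcal L-q)H(v;b_1^* )=\tfrac{\sigma^2}2g'(v)+\mu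 g(v)-qH(v;b_1^* ),$$ and for $b_1^*\le v<z$ $$F(v,z;b_1^* )=\frac{g(z)-qH(v;b_1^* )W(z-v)}{W'(z-v)},\qquad F(v,v;b_1^* ):=\lim_{z\downarrow v}F(v,z;b_1^* )=\tfrac{\sigma^2}2g(v).$$ One has $\partial_zF(v,v+;b_1^* )=(\mathcal L-q)H(v;b_1^* )$. Let $b_1^{(1)}>b_1^*$ be such that $F'(v)<0$ for $v\in(b_1^*,b_1^{(1)})$ and $F(v)>F(z)$ for all $v\in(b_1^*,b_1^{(1)})$, $z>v$. Let $\mathcal P_1$ be the set of $\tilde v>b_1^{(1)}$ such that, for some $\varepsilon>0$, $(\mathcal L-q)H(v;b_1^* )$ is $\le0$ for $v\in(\tilde v-\varepsilon,\tilde v)$, $=0$ at $v=\tilde v$, and $>0$ for $v\in(\tilde v,\tilde v+\varepsilon)$; $c_1=\min\mathcal P_1$. For $v\in[b_1^*,c_1]$ let $$z_1(v)=\sup\{y\ge v:F(v,y;b_1^* )\ge F(v,z;b_1^* )\ \forall z\ge v\},\qquad\mathcal D_1=\{v\in[b_1^*,c_1]:v<z_1(v)\}.$$ *)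

(* Defs.v *)
From Stdlib Require Import Reals Lra.
From Coquelicot Require Import Coquelicot.
Open Scope R_scope.

Definition sdisc (mu sigma q : R) : R := sqrt (mu ^ 2 + 2 * q * sigma ^ 2).

Definition Phi (mu sigma q : R) : R := (sdisc mu sigma q - mu) / sigma ^ 2.

Definition zeta1 (mu sigma q : R) : R := (sdisc mu sigma q + mu) / sigma ^ 2.

(* The exponential formula is used on the whole line, although W is only
   evaluated on [0, +oo): this way [Derive W 0] is the right derivative of W
   at 0. *)
Definition W (mu sigma q x : R) : R :=
  / sdisc mu sigma q
  * (exp (Phi mu sigma q * x) - exp (- zeta1 mu sigma q * x)).

Definition W' (mu sigma q x : R) : R := Derive (W mu sigma q) x.

Definition gen (mu sigma : R) (f : R -> R) (x : R) : R :=
  sigma ^ 2 / 2 * Derive_n f 2 x + mu * Derive f x.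

(* Functions on (0, +oo) extended continuously to 0 are represented by total
   functions g : R -> R whose values on (-oo, 0) are never used; g 0 is the
   extension. *)

Definition F1 (mu sigma q : R) (g : R -> R) (u : R) : R :=
  g u / W' mu sigma q u.

Definition b1star (mu sigma q : R) (g : R -> R) : R :=
  real (Lub_Rbar (fun u => 0 <= u /\
    forall x, 0 <= x -> F1 mu sigma q g u >= F1 mu sigma q g x)).

Definition H (mu sigma q : R) (g : R -> R) (b x : R) : R :=
  RInt g b x + g b * (W mu sigma q b / W' mu sigma q b).

(* (L - q) H(.; b), which is also the derivative of z |-> F(v, z; b) at
   z = v+ (see [is_derive_F2_diag]). *)
Definition LqH (mu sigma q : R) (g : R -> R) (b v : R) : R :=
  gen mu sigma (H mu sigma q g b) v - q * H mu sigma q g b v.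

(* No case distinction is needed on the diagonal: since W(0) = 0 and W'(0) > 0,
   the quotient at z = v is the limit as z decreases to v (see [F2_diag] and
   [F2_diag_lim]). *)
Definition F2 (mu sigma q : R) (g : R -> R) (b v z : R) : R :=
  (g z - q * H mu sigma q g b v * W mu sigma q (z - v)) / W' mu sigma q (z - v).

Definition P1 (mu sigma q : R) (g : R -> R) (b b' w : R) : Prop :=
  b' < w /\
  exists eps, 0 < eps /\
    (forall v, w - eps < v < w -> LqH mu sigma q g b v <= 0) /\
    LqH mu sigma q g b w = 0 /\
    (forall v, w < v < w + eps -> LqH mu sigma q g b v > 0).

Definition is_min (E : R -> Prop) (m : R) : Prop :=
  E m /\ forall x, E x -> m <= x.

Definition z1 (mu sigma q : R) (g : R -> R) (b v : R) : Rbar :=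
  Lub_Rbar (fun y => v <= y /\
    forall z, v <= z -> F2 mu sigma q g b v y >= F2 mu sigma q g b v z).

Definition D1 (mu sigma q : R) (g : R -> R) (b c v : R) : Prop :=
  b <= v <= c /\ Rbar_lt v (z1 mu sigma q g b v).

(* [real] sends the infinite values to 0; b2star > b1star >= 0 and
   b3star > b2star hence exclude that the infimum or the supremum is
   infinite. *)
Definition b2star (mu sigma q : R) (g : R -> R) (b c : R) : R :=
  real (Glb_Rbar (D1 mu sigma q g b c)).

Definition b3star (mu sigma q : R) (g : R -> R) (b c : R) : R :=
  real (z1 mu sigma q g b (b2star mu sigma q g b c)).

Lemma sdisc_pos mu sigma q : 0 < sigma -> 0 < q -> 0 < sdisc mu sigma q.
Proof.
intros hs hq; apply sqrt_lt_R0.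
assert (0 < sigma ^ 2) by (apply pow_lt; lra).
assert (0 < q * sigma ^ 2) by (apply Rmult_lt_0_compat; lra).
assert (0 <= mu ^ 2) by apply pow2_ge_0.
lra.
Qed.

Lemma is_derive_W mu sigma q x :
  is_derive (W mu sigma q) x
    (/ sdisc mu sigma q
     * (Phi mu sigma q * exp (Phi mu sigma q * x)
        + zeta1 mu sigma q * exp (- zeta1 mu sigma q * x))).
Proof. unfold W; auto_derive; [trivial | ring]. Qed.

Lemma W'E mu sigma q x :
  W' mu sigma q x
  = / sdisc mu sigma q
    * (Phi mu sigma q * exp (Phi mu sigma q * x)
       + zeta1 mu sigma q * exp (- zeta1 mu sigma q * x)).
Proof. apply is_derive_unique, is_derive_W. Qed.

Lemma W_0 mu sigma q : W mu sigma q 0 = 0.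
Proof. unfold W; rewrite 2!Rmult_0_r; ring. Qed.

Lemma W'_0 mu sigma q : 0 < sigma -> 0 < q -> W' mu sigma q 0 = 2 / sigma ^ 2.
Proof.
intros hs hq; rewrite W'E, 2!Rmult_0_r, exp_0; unfold Phi, zeta1.
assert (h := sdisc_pos mu sigma q hs hq).
field; split; lra.
Qed.

Lemma is_derive_W' mu sigma q x :
  is_derive (W' mu sigma q) x
    (/ sdisc mu sigma q
     * (Phi mu sigma q ^ 2 * exp (Phi mu sigma q * x)
        - zeta1 mu sigma q ^ 2 * exp (- zeta1 mu sigma q * x))).
Proof.
apply (is_derive_ext (fun x => / sdisc mu sigma q
    * (Phi mu sigma q * exp (Phi mu sigma q * x)
       + zeta1 mu sigma q * exp (- zeta1 mu sigma q * x)))).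
- intros t; symmetry; apply W'E.
- auto_derive; [trivial | ring].
Qed.

Lemma F2_diag mu sigma q g b v : 0 < sigma -> 0 < q ->
  F2 mu sigma q g b v v = sigma ^ 2 / 2 * g v.
Proof.
intros hs hq; unfold F2; rewrite Rminus_diag, W_0, W'_0 by assumption.
field; lra.
Qed.

Lemma F2_diag_lim mu sigma q g b v : 0 < sigma -> 0 < q ->
  filterlim g (at_right v) (locally (g v)) ->
  filterlim (F2 mu sigma q g b v) (at_right v)
    (locally (sigma ^ 2 / 2 * g v)).
Proof.
intros hs hq hg.
rewrite <- (F2_diag mu sigma q g b v hs hq); unfold F2, Rdiv.
assert (Hm : forall f : R -> R, ex_derive f 0 ->
  filterlim (fun z => f (z - v)) (at_right v) (locally (f (v - v)))).
{ intros f hf; apply (filterlim_filter_le_1 (F := locally v)).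
  { apply filter_le_within. }
  apply (ex_derive_continuous (fun z => f (z - v))).
  apply (ex_derive_comp f (fun z => z - v)).
  - rewrite Rminus_diag; exact hf.
  - auto_derive; trivial. }
apply (filterlim_comp_2 (F := at_right v) (H := locally (/ W' mu sigma q (v - v)))
  (G := locally (g v - q * H mu sigma q g b v * W mu sigma q (v - v)))
  _ (fun z => / W' mu sigma q (z - v)) Rmult).
- apply (filterlim_comp_2 (F := at_right v) (G := locally (g v))
    (H := locally (- (q * H mu sigma q g b v * W mu sigma q (v - v))))
    g (fun z => - (q * H mu sigma q g b v * W mu sigma q (z - v))) Rplus).
  + exact hg.
  + apply (Hm (fun y => - (q * H mu sigma q g b v * W mu sigma q y))).
    apply (ex_derive_opp (fun y => q * H mu sigma q g b v * W mu sigma q y)).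
    apply ex_derive_scal; eexists; apply is_derive_W.
  + apply (filterlim_plus (K := R_AbsRing) (V := R_NormedModule)).
- apply (Hm (fun y => / W' mu sigma q y)).
  apply ex_derive_inv.
  + eexists; apply is_derive_W'.
  + rewrite W'_0 by assumption.
    apply Rgt_not_eq, Rdiv_lt_0_compat; [lra | apply pow_lt; lra].
- apply (filterlim_mult (K := R_AbsRing)).
Qed.

Lemma is_derive_H mu sigma q g b v : 0 <= b -> 0 < v ->
  (forall x, 0 < x -> continuous g x) ->
  filterlim g (at_right 0) (locally (g 0)) ->
  is_derive (H mu sigma q g b) v (g v).
Proof.
intros hb hv hc h0; unfold H.
(* g agrees on [0, +oo) with the continuous function g (Rmax 0 _) *)
assert (hcm : forall x, continuous (fun y => g (Rmax 0 y)) x).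
{ intros x; destruct (Rtotal_order x 0) as [hx | [-> | hx]].
  - apply (continuous_ext_loc _ (fun _ => g 0)).
    + exists (mkposreal (- x) ltac:(lra)); intros y hy.
      unfold ball in hy; simpl in hy; unfold AbsRing_ball, abs, minus, plus, opp in hy;
        simpl in hy.
      apply Rabs_def2 in hy; rewrite Rmax_left; [reflexivity | lra].
    + apply continuous_const.
  - intros P; rewrite Rmax_left by lra; intros hP.
    destruct (h0 P hP) as [d hd]; exists d; intros y hy.
    destruct (Rle_lt_dec y 0) as [h | h].
    + rewrite Rmax_left by lra; apply locally_singleton in hP; exact hP.
    + rewrite Rmax_right by lra; apply hd; [exact hy | exact h].
  - apply (continuous_ext_loc _ g).
    + exists (mkposreal x hx); intros y hy.
      unfold ball in hy; simpl in hy; unfold AbsRing_ball, abs, minus, plus, opp in hy;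
        simpl in hy.
      apply Rabs_def2 in hy; rewrite Rmax_right; [reflexivity | lra].
    + apply hc; exact hx. }
evar_last.
apply (is_derive_plus (fun x => RInt g b x)
  (fun _ => g b * (W mu sigma q b / W' mu sigma q b))).
2: apply is_derive_const.
2: apply Rplus_0_r.
apply (is_derive_ext_loc (fun x => RInt (fun y => g (Rmax 0 y)) b x)).
- exists (mkposreal v hv); intros y hy.
  unfold ball in hy; simpl in hy; unfold AbsRing_ball, abs, minus, plus, opp in hy;
    simpl in hy.
  apply Rabs_def2 in hy.
  apply RInt_ext; intros x hx.
  assert (0 <= Rmin b y) by (apply Rmin_glb; lra).
  rewrite Rmax_right; [reflexivity | lra].
- replace (g v) with (g (Rmax 0 v)) by (rewrite Rmax_right; [reflexivity | lra]).
  apply (is_derive_RInt (fun y => g (Rmax 0 y)) _ b).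
  + exists (mkposreal 1 Rlt_0_1); intros y _.
    apply (RInt_correct (V := R_CompleteNormedModule)).
    apply (ex_RInt_continuous (V := R_CompleteNormedModule)).
    intros; apply hcm.
  + apply hcm.
Qed.

Lemma LqHE mu sigma q g b v : 0 <= b -> 0 < v ->
  (forall x, 0 < x -> continuous g x) ->
  filterlim g (at_right 0) (locally (g 0)) ->
  LqH mu sigma q g b v
  = sigma ^ 2 / 2 * Derive g v + mu * g v - q * H mu sigma q g b v.
Proof.
intros hb hv hc h0; unfold LqH, gen.
assert (hd : forall x, 0 < x -> Derive (H mu sigma q g b) x = g x).
{ intros x hx; apply is_derive_unique, is_derive_H; assumption. }
rewrite (hd v hv).
replace (Derive_n (H mu sigma q g b) 2 v) with (Derive g v); [reflexivity |].
symmetry; apply Derive_ext_loc.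
exists (mkposreal v hv); intros y hy.
unfold ball in hy; simpl in hy; unfold AbsRing_ball, abs, minus, plus, opp in hy;
  simpl in hy.
apply Rabs_def2 in hy; apply hd; lra.
Qed.

Lemma is_derive_F2_diag mu sigma q g b v : 0 < sigma -> 0 < q ->
  0 <= b -> 0 < v ->
  (forall x, 0 < x -> ex_derive g x) ->
  filterlim g (at_right 0) (locally (g 0)) ->
  is_derive (F2 mu sigma q g b v) v (LqH mu sigma q g b v).
Proof.
intros hs hq hb hv hg h0.
assert (hc : forall x, 0 < x -> continuous g x).
{ intros x hx; apply ex_derive_continuous, hg, hx. }
rewrite LqHE by assumption; unfold F2.
assert (hpos := sdisc_pos mu sigma q hs hq).
assert (hW0 := W'_0 mu sigma q hs hq).
assert (hdW := is_derive_W mu sigma q 0); rewrite <- W'E in hdW.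
assert (hdW' := is_derive_W' mu sigma q 0).
rewrite 2!Rmult_0_r, exp_0 in hdW'.
assert (hs2 : 0 < sigma ^ 2) by (apply pow_lt; lra).
evar_last.
apply (is_derive_div (fun z => g z - q * H mu sigma q g b v * W mu sigma q (z - v))
  (fun z => W' mu sigma q (z - v)) v).
- apply (is_derive_minus g
    (fun z => q * H mu sigma q g b v * W mu sigma q (z - v))).
  + apply Derive_correct, hg, hv.
  + apply is_derive_scal.
    apply (is_derive_comp (W mu sigma q) (fun z => z - v)).
    * rewrite Rminus_diag; exact hdW.
    * instantiate (1 := 1); auto_derive; [trivial | ring].
- apply (is_derive_comp (W' mu sigma q) (fun z => z - v)).
  + rewrite Rminus_diag; exact hdW'.
  + instantiate (1 := 1); auto_derive; [trivial | ring].
- rewrite Rminus_diag, hW0; apply Rgt_not_eq, Rdiv_lt_0_compat; lra.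
- rewrite Rminus_diag, W_0, hW0.
  unfold minus, plus, opp, scal; simpl; unfold mult; simpl.
  unfold Phi, zeta1; field; lra.
Qed.

(* Main.v *)
(* Write F(v, z) - F(v, v) = gap(v, z) / W'(z - v).  As F(v, .) attains
   its maximum, v lies in D_1 iff gap(v, z) >= 0 for some z > v.  Since
   gap(z, z) = 0 and d/dv gap(v, z) = - W'(z - v) (L - q)H(v), the sign of
   (L - q)H on (v, z) determines the sign of gap(v, z).
   - Right of c_1, (L - q)H > 0, so gap(c_1, z) > 0 for some z, and by continuity
     points left of c_1 are in D_1: b_2 < c_1.
   - On [b_1, b_1^(1)) the monotonicity of F_1 gives gap(v, .) < 0: b_1 < b_2.
   - Points of D_1 approaching b_2 have a witness z beyond b_2 + eps_1 because
     (L - q)H < 0 on (b_2, b_2 + eps_1), and gap(v, z), rescaled by exp(- Phi z),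
     is continuous in v uniformly in z, so b_2 itself has a witness: b_2 < b_3.
   - If gap(b_2, b_3) were positive, points left of b_2 would be in D_1. *)
Require Import Defs.
From Stdlib Require Import Reals Lra Classical.
From Coquelicot Require Import Coquelicot.
Open Scope R_scope.

(** * Characteristic roots and identities for the scale function [W] *)

Lemma sdisc_sqr mu sigma q : 0 < sigma -> 0 < q ->
  sdisc mu sigma q ^ 2 = mu ^ 2 + 2 * q * sigma ^ 2.
Proof.
intros hs hq; unfold sdisc; apply pow2_sqrt.
assert (0 <= mu ^ 2) by apply pow2_ge_0.
assert (0 < q * sigma ^ 2) by (apply Rmult_lt_0_compat; [lra | apply pow_lt; lra]).
lra.
Qed.

(** Both exponents [Phi] and [zeta1] owe their positivity to this bound; it holds because [Rabs mu]
    is the square root of [mu ^ 2] and [q * sigma ^ 2 > 0]. *)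
Lemma sdisc_gt_abs mu sigma q : 0 < sigma -> 0 < q -> Rabs mu < sdisc mu sigma q.
Proof.
intros hs hq; rewrite <- sqrt_Rsqr_abs; apply sqrt_lt_1_alt; split.
- apply Rle_0_sqr.
- assert (0 < q * sigma ^ 2) by (apply Rmult_lt_0_compat; [lra | apply pow_lt; lra]).
  unfold Rsqr; lra.
Qed.

Lemma Phi_pos mu sigma q : 0 < sigma -> 0 < q -> 0 < Phi mu sigma q.
Proof.
intros hs hq; assert (h := sdisc_gt_abs mu sigma q hs hq).
apply Rabs_def2 in h; apply Rdiv_lt_0_compat; [lra | apply pow_lt; lra].
Qed.

Lemma zeta1_pos mu sigma q : 0 < sigma -> 0 < q -> 0 < zeta1 mu sigma q.
Proof.
intros hs hq; assert (h := sdisc_gt_abs mu sigma q hs hq).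
apply Rabs_def2 in h; apply Rdiv_lt_0_compat; [lra | apply pow_lt; lra].
Qed.

(** [Phi] and [- zeta1] are the two roots of the characteristic polynomial of [L - q]. *)
Lemma Phi_root mu sigma q : 0 < sigma -> 0 < q ->
  sigma ^ 2 / 2 * Phi mu sigma q ^ 2 + mu * Phi mu sigma q = q.
Proof.
intros hs hq; assert (h := sdisc_sqr mu sigma q hs hq).
unfold Phi; set (s := sdisc mu sigma q) in *.
(* With [q] expressed through [s], the square root becomes a free variable and the goal a rational
   identity. *)
replace q with ((s ^ 2 - mu ^ 2) / (2 * sigma ^ 2)) by (rewrite h; field; lra).
field; lra.
Qed.

Lemma zeta1_root mu sigma q : 0 < sigma -> 0 < q ->
  sigma ^ 2 / 2 * zeta1 mu sigma q ^ 2 - mu * zeta1 mu sigma q = q.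
Proof.
intros hs hq; assert (h := sdisc_sqr mu sigma q hs hq).
unfold zeta1; set (s := sdisc mu sigma q) in *.
replace q with ((s ^ 2 - mu ^ 2) / (2 * sigma ^ 2)) by (rewrite h; field; lra).
field; lra.
Qed.

Lemma W'_pos mu sigma q x : 0 < sigma -> 0 < q -> 0 < W' mu sigma q x.
Proof.
intros hs hq; rewrite W'E.
apply Rmult_lt_0_compat; [apply Rinv_0_lt_compat, sdisc_pos; assumption |].
apply Rplus_lt_0_compat; apply Rmult_lt_0_compat; try apply exp_pos.
- apply Phi_pos; assumption.
- apply zeta1_pos; assumption.
Qed.

Lemma W_ge0 mu sigma q x : 0 < sigma -> 0 < q -> 0 <= x -> 0 <= W mu sigma q x.
Proof.
intros hs hq hx.
assert (hP := Phi_pos mu sigma q hs hq); assert (hz := zeta1_pos mu sigma q hs hq).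
apply Rmult_le_pos.
- apply Rlt_le, Rinv_0_lt_compat, sdisc_pos; assumption.
- destruct hx as [hx | <-]; [| rewrite 2!Rmult_0_r; lra].
  assert (exp (- zeta1 mu sigma q * x) < exp (Phi mu sigma q * x)); [| lra].
  apply exp_increasing; nra.
Qed.

(** This is [(L - q)W = 0]: each of the two exponentials solves it because its exponent is a
    characteristic root. *)
Lemma W_ode mu sigma q x : 0 < sigma -> 0 < q ->
  sigma ^ 2 / 2 * Derive (W' mu sigma q) x + mu * W' mu sigma q x
  = q * W mu sigma q x.
Proof.
intros hs hq; assert (h := sdisc_pos mu sigma q hs hq).
rewrite (is_derive_unique _ _ _ (is_derive_W' mu sigma q x)), W'E; unfold W.
transitivity (/ sdisc mu sigma q
  * ((sigma ^ 2 / 2 * Phi mu sigma q ^ 2 + mu * Phi mu sigma q)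
       * exp (Phi mu sigma q * x)
     - (sigma ^ 2 / 2 * zeta1 mu sigma q ^ 2 - mu * zeta1 mu sigma q)
       * exp (- zeta1 mu sigma q * x))); [ring |].
rewrite Phi_root, zeta1_root by assumption; ring.
Qed.

(** The mixed exponentials cancel because [Phi * zeta1 = 2 * q / sigma ^ 2]; the pure ones match
    because [Phi + zeta1 = 2 * s / sigma ^ 2], where [s] is [sdisc]. *)
Lemma W'_add mu sigma q x y : 0 < sigma -> 0 < q ->
  W' mu sigma q (x + y)
  = q * W mu sigma q x * W mu sigma q y
    + sigma ^ 2 / 2 * W' mu sigma q x * W' mu sigma q y.
Proof.
intros hs hq; assert (h := sdisc_pos mu sigma q hs hq).
assert (h2 := sdisc_sqr mu sigma q hs hq).
rewrite 3!W'E; unfold W.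
rewrite (Rmult_plus_distr_l (Phi mu sigma q)), (Rmult_plus_distr_l (- zeta1 mu sigma q)).
rewrite 2!exp_plus.
set (a := exp (Phi mu sigma q * x)); set (b := exp (Phi mu sigma q * y)).
set (c := exp (- zeta1 mu sigma q * x)); set (d := exp (- zeta1 mu sigma q * y)).
unfold Phi, zeta1; set (s := sdisc mu sigma q) in *.
replace q with ((s ^ 2 - mu ^ 2) / (2 * sigma ^ 2)) by (rewrite h2; field; lra).
field; lra.
Qed.

(** * The gap and its derivative in the first argument *)

(* d/dz (H(z) - U(z)), where (L - q)U = 0, U(v) = H(v) and U'(v) = g(v); it is
   also (F2 v z - F2 v v) W'(z - v). *)
Definition gap (mu sigma q : R) (g : R -> R) (b v z : R) : R :=
  g z - q * H mu sigma q g b v * W mu sigma q (z - v)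
  - sigma ^ 2 / 2 * g v * W' mu sigma q (z - v).

Lemma F2_gap mu sigma q g b v z : 0 < sigma -> 0 < q ->
  F2 mu sigma q g b v z
  = F2 mu sigma q g b v v + gap mu sigma q g b v z / W' mu sigma q (z - v).
Proof.
intros hs hq; rewrite F2_diag by assumption; unfold F2, gap.
assert (h := W'_pos mu sigma q (z - v) hs hq).
field; lra.
Qed.

Lemma F2_ge_diag mu sigma q g b v z : 0 < sigma -> 0 < q ->
  F2 mu sigma q g b v z >= F2 mu sigma q g b v v <-> 0 <= gap mu sigma q g b v z.
Proof.
intros hs hq; rewrite (F2_gap mu sigma q g b v z) by assumption.
assert (h := W'_pos mu sigma q (z - v) hs hq).
split; intros hg.
- apply Rnot_lt_le; intros hn.
  assert (gap mu sigma q g b v z / W' mu sigma q (z - v) < 0); [| lra].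
  apply Rmult_neg_pos; [exact hn | apply Rinv_0_lt_compat; exact h].
- assert (0 <= gap mu sigma q g b v z / W' mu sigma q (z - v)); [| lra].
  apply Rmult_le_pos; [exact hg | apply Rlt_le, Rinv_0_lt_compat; exact h].
Qed.

(** Differentiation in [v] produces [g v * (q * W - sigma ^ 2 / 2 * W'')], which the equation for
    [W] turns into [mu * g v * W']. Then [W' (z - v)] is a common factor, and the other factor is
    [- (L - q)H]. *)
Lemma is_derive_gap mu sigma q g b v z : 0 < sigma -> 0 < q ->
  0 <= b -> 0 < v ->
  (forall x, 0 < x -> ex_derive g x) ->
  filterlim g (at_right 0) (locally (g 0)) ->
  is_derive (fun v => gap mu sigma q g b v z) v
    (- (W' mu sigma q (z - v) * LqH mu sigma q g b v)).
Proof.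
intros hs hq hb hv hg h0.
assert (hc : forall x, 0 < x -> continuous g x).
{ intros x hx; apply (ex_derive_continuous g), hg, hx. }
rewrite LqHE by assumption.
assert (hH := is_derive_H mu sigma q g b v hb hv hc h0).
assert (hgv := hg v hv).
assert (hW : ex_derive (W mu sigma q) (z - v)) by (eexists; apply is_derive_W).
assert (hW' : ex_derive (W' mu sigma q) (z - v)) by (eexists; apply is_derive_W').
assert (ho := W_ode mu sigma q (z - v) hs hq).
unfold gap; auto_derive.
- repeat split; auto; eexists; exact hH.
- change (Derive (fun x => W mu sigma q x) (z + - v)) with (W' mu sigma q (z - v)).
  change (Derive (fun x => H mu sigma q g b x) v) with (Derive (H mu sigma q g b) v).
  rewrite (is_derive_unique _ _ _ hH).
  change (Derive (fun x => W' mu sigma q x) (z + - v))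
    with (Derive (W' mu sigma q) (z - v)).
  change (Derive (fun x => g x) v) with (Derive g v).
  change (z + - v) with (z - v).
  transitivity (q * H mu sigma q g b v * W' mu sigma q (z - v)
    - sigma ^ 2 / 2 * Derive g v * W' mu sigma q (z - v)
    - g v * (q * W mu sigma q (z - v) - sigma ^ 2 / 2 * Derive (W' mu sigma q) (z - v)));
    [field |].
  rewrite <- ho; ring.
Qed.

(* The weak form of gap v z = int_v^z W'(z - y) (L - q)H(y) dy that suffices to
   transfer the sign of (L - q)H. *)
Lemma gap_mean_value mu sigma q g b v z : 0 < sigma -> 0 < q ->
  0 <= b -> 0 < v < z ->
  (forall x, 0 < x -> ex_derive g x) ->
  filterlim g (at_right 0) (locally (g 0)) ->
  exists y k, v < y < z /\ 0 < k /\
    gap mu sigma q g b v z = k * LqH mu sigma q g b y.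
Proof.
intros hs hq hb hv hg h0.
destruct (MVT_cor2 (fun v => gap mu sigma q g b v z)
  (fun y => - (W' mu sigma q (z - y) * LqH mu sigma q g b y)) v z) as [y [he hy]].
- lra.
- intros c hc; apply is_derive_Reals, is_derive_gap; try assumption; lra.
- exists y, (W' mu sigma q (z - y) * (z - v)).
  assert (hp := W'_pos mu sigma q (z - y) hs hq).
  split; [exact hy |]; split; [apply Rmult_lt_0_compat; lra |].
  assert (hd : gap mu sigma q g b z z = 0).
  { unfold gap; rewrite Rminus_diag, W_0, W'_0 by assumption; field; lra. }
  simpl in he; rewrite hd in he; lra.
Qed.

(** * Exponential form of the gap *)

(** [gapA] and [gapB] are the coefficients of [exp (Phi * z)] and [exp (- zeta1 * z)] in the
    function of [z] that the gap subtracts from [g z]. *)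
Definition gapA (mu sigma q : R) (g : R -> R) (b v : R) : R :=
  exp (- (Phi mu sigma q * v))
  * (q * H mu sigma q g b v + sigma ^ 2 / 2 * g v * Phi mu sigma q) / sdisc mu sigma q.

Definition gapB (mu sigma q : R) (g : R -> R) (b v : R) : R :=
  exp (zeta1 mu sigma q * v)
  * (sigma ^ 2 / 2 * g v * zeta1 mu sigma q - q * H mu sigma q g b v) / sdisc mu sigma q.

Definition scaled_gap (mu sigma q : R) (g : R -> R) (b v z : R) : R :=
  g z / exp (Phi mu sigma q * z) - gapA mu sigma q g b v
  - gapB mu sigma q g b v * exp (- ((Phi mu sigma q + zeta1 mu sigma q) * z)).

Lemma gap_exp mu sigma q g b v z : 0 < sigma -> 0 < q ->
  gap mu sigma q g b v z
  = exp (Phi mu sigma q * z) * scaled_gap mu sigma q g b v z.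
Proof.
intros hs hq; assert (h := sdisc_pos mu sigma q hs hq).
unfold gap, scaled_gap, gapA, gapB; rewrite W'E; unfold W.
replace (Phi mu sigma q * (z - v)) with (Phi mu sigma q * z + - (Phi mu sigma q * v)) by ring.
replace (- zeta1 mu sigma q * (z - v))
  with (Phi mu sigma q * z + (- ((Phi mu sigma q + zeta1 mu sigma q) * z) + zeta1 mu sigma q * v))
  by ring.
rewrite !exp_plus.
assert (hp := exp_pos (Phi mu sigma q * z)).
field; lra.
Qed.

(** * Sign of the gap on the initial interval *)

Lemma ex_RInt_half_line g a b : 0 <= a <= b ->
  (forall x, 0 < x -> continuous g x) ->
  filterlim g (at_right 0) (locally (g 0)) ->
  @ex_RInt R_NormedModule g a b.
Proof.
intros hab hc h0.
(* At 0 only the limit of [g] from the right is known, so [g] is replaced by a continuous extension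
   [e]. It is continuous only below its right bound, hence [b + 1] in order to include [b]. *)
destruct (C0_extension_left (T := R_UniformSpace) g (g 0) 0 (b + 1)) as [e [he [heq _]]].
- lra.
- intros c hc'; apply hc; lra.
- exact h0.
- apply (ex_RInt_ext (V := R_NormedModule) e).
  + rewrite Rmin_left, Rmax_right by lra; intros x hx; apply heq; lra.
  + apply (ex_RInt_continuous (V := R_CompleteNormedModule)).
    rewrite Rmin_left, Rmax_right by lra; intros x hx; apply he; lra.
Qed.

Lemma nonneg_at_0 g : (forall x, 0 < x -> 0 < g x) ->
  filterlim g (at_right 0) (locally (g 0)) -> 0 <= g 0.
Proof.
intros hp h0.
apply (filterlim_le (F := at_right 0) (fun _ => 0) g 0 (g 0)).
- exists (mkposreal 1 Rlt_0_1); intros y _ hy; apply Rlt_le, hp, hy.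
- apply filterlim_const.
- exact h0.
Qed.

Lemma H_ge0 mu sigma q g b v : 0 < sigma -> 0 < q -> 0 <= b <= v ->
  (forall x, 0 < x -> 0 < g x) ->
  (forall x, 0 < x -> continuous g x) ->
  filterlim g (at_right 0) (locally (g 0)) ->
  0 <= H mu sigma q g b v.
Proof.
intros hs hq hb hp hc h0; apply Rplus_le_le_0_compat.
- apply RInt_ge_0; [lra | apply ex_RInt_half_line; assumption |].
  intros x hx; apply Rlt_le, hp; lra.
- apply Rmult_le_pos.
  + destruct (Req_dec b 0) as [-> | hb0]; [apply nonneg_at_0; assumption |].
    apply Rlt_le, hp; lra.
  + apply Rmult_le_pos; [apply W_ge0; lra |].
    apply Rlt_le, Rinv_0_lt_compat, W'_pos; assumption.
Qed.

Lemma F1_mul_W' mu sigma q g u : 0 < sigma -> 0 < q ->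
  F1 mu sigma q g u * W' mu sigma q u = g u.
Proof.
intros hs hq; assert (h := W'_pos mu sigma q u hs hq).
unfold F1; field; lra.
Qed.

(** With [k = F1 v], the hypothesis gives [g y >= k * W' y] on [[b, v]]. Integration bounds the
    integral in [H] by [k * (W v - W b)] from below, and the constant term [F1 b * W b] is at least
    [k * W b]. *)
Lemma F1_W_le_H mu sigma q g b v : 0 < sigma -> 0 < q -> 0 <= b <= v ->
  (forall x, 0 < x -> continuous g x) ->
  filterlim g (at_right 0) (locally (g 0)) ->
  (forall y, b <= y <= v -> F1 mu sigma q g v <= F1 mu sigma q g y) ->
  F1 mu sigma q g v * W mu sigma q v <= H mu sigma q g b v.
Proof.
intros hs hq hb hc h0 hF; set (k := F1 mu sigma q g v) in *.
assert (hI : is_RInt (fun y => k * W' mu sigma q y) b v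
    (k * W mu sigma q v - k * W mu sigma q b)).
{ apply (is_RInt_derive (V := R_CompleteNormedModule) (fun y => k * W mu sigma q y)).
  - intros x _; apply is_derive_scal; rewrite W'E; apply is_derive_W.
  - intros x _; apply (ex_derive_continuous (fun y => k * W' mu sigma q y)).
    apply ex_derive_scal; eexists; apply is_derive_W'. }
assert (hle : RInt (fun y => k * W' mu sigma q y) b v <= RInt g b v).
{ apply (RInt_le (fun y => k * W' mu sigma q y)); [lra | eexists; exact hI | apply ex_RInt_half_line; assumption |].
  intros x hx; rewrite <- (F1_mul_W' mu sigma q g x) by assumption.
  apply Rmult_le_compat_r; [apply Rlt_le, W'_pos; assumption | apply hF; lra]. }
rewrite (is_RInt_unique _ _ _ _ hI) in hle.
unfold H.
replace (g b * (W mu sigma q b / W' mu sigma q b))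
  with (F1 mu sigma q g b * W mu sigma q b) by (unfold F1, Rdiv; ring).
assert (k * W mu sigma q b <= F1 mu sigma q g b * W mu sigma q b); [| lra].
apply Rmult_le_compat_r; [apply W_ge0; lra | apply hF; lra].
Qed.

(** The addition formula at [z = v + (z - v)], multiplied by [F1 v], reproduces the term in
    [W' (z - v)]. What remains separates the variation of [F1] from the excess of [H], whose signs
    are controlled independently. *)
Lemma gap_F1 mu sigma q g b v z : 0 < sigma -> 0 < q ->
  gap mu sigma q g b v z
  = W' mu sigma q z * (F1 mu sigma q g z - F1 mu sigma q g v)
    - q * (H mu sigma q g b v - F1 mu sigma q g v * W mu sigma q v) * W mu sigma q (z - v).
Proof.
intros hs hq; unfold gap.
rewrite Rmult_minus_distr_l, (Rmult_comm _ (F1 mu sigma q g z)), F1_mul_W' by assumption.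
assert (h := W'_add mu sigma q v (z - v) hs hq).
replace (v + (z - v)) with z in h by ring.
rewrite h, <- (F1_mul_W' mu sigma q g v) by assumption; ring.
Qed.

Lemma gap_lt0_of_F1 mu sigma q g b v z : 0 < sigma -> 0 < q -> 0 <= b <= v -> v < z ->
  (forall x, 0 < x -> continuous g x) ->
  filterlim g (at_right 0) (locally (g 0)) ->
  (forall y, b <= y <= v -> F1 mu sigma q g v <= F1 mu sigma q g y) ->
  F1 mu sigma q g z < F1 mu sigma q g v ->
  gap mu sigma q g b v z < 0.
Proof.
intros hs hq hb hz hc h0 hF hlt; rewrite gap_F1 by assumption.
assert (h1 := F1_W_le_H mu sigma q g b v hs hq hb hc h0 hF).
assert (h2 : 0 < W' mu sigma q z * (F1 mu sigma q g v - F1 mu sigma q g z)).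
{ apply Rmult_lt_0_compat; [apply W'_pos; assumption | lra]. }
assert (h3 : 0 <= q * (H mu sigma q g b v - F1 mu sigma q g v * W mu sigma q v)
    * W mu sigma q (z - v)).
{ apply Rmult_le_pos; [| apply W_ge0; lra]; apply Rmult_le_pos; lra. }
lra.
Qed.

Lemma F1_right_continuous mu sigma q g b : 0 < sigma -> 0 < q -> 0 <= b ->
  (forall x, 0 < x -> continuous g x) ->
  filterlim g (at_right 0) (locally (g 0)) ->
  filterlim (F1 mu sigma q g) (at_right b) (locally (F1 mu sigma q g b)).
Proof.
intros hs hq hb hc h0.
apply (filterlim_comp_2 (F := at_right b) (G := locally (g b))
  (H := locally (/ W' mu sigma q b)) g (fun z => / W' mu sigma q z) Rmult).
- destruct (Req_dec b 0) as [-> | hb0]; [exact h0 |].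
  apply (filterlim_filter_le_1 (F := locally b)); [apply filter_le_within |].
  apply hc; lra.
- apply (filterlim_filter_le_1 (F := locally b)); [apply filter_le_within |].
  apply (ex_derive_continuous (fun z => / W' mu sigma q z)).
  apply ex_derive_inv; [eexists; apply is_derive_W' |].
  apply Rgt_not_eq, W'_pos; assumption.
- apply (filterlim_mult (K := R_AbsRing)).
Qed.

Lemma gap_lt0_initial mu sigma q g b b' v z : 0 < sigma -> 0 < q ->
  0 <= b -> b <= v < b' -> v < z ->
  (forall x, 0 < x -> continuous g x) ->
  filterlim g (at_right 0) (locally (g 0)) ->
  (forall x y, b < x < b' -> x < y -> F1 mu sigma q g x > F1 mu sigma q g y) ->
  gap mu sigma q g b v z < 0.
Proof.
intros hs hq hb hv hz hc h0 hF.
(* The decrease is assumed only on the open interval; the comparison with the left endpoint is a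
   limit from the right, since [b] may be 0. *)
assert (hFb : forall y, b < y < b' -> F1 mu sigma q g y <= F1 mu sigma q g b).
{ intros y hy.
  apply (filterlim_le (F := at_right b) (fun _ => F1 mu sigma q g y) (F1 mu sigma q g)
    (F1 mu sigma q g y) (F1 mu sigma q g b)).
  - exists (mkposreal (y - b) ltac:(lra)); intros x hx hbx.
    apply Rlt_le, hF; unfold ball in hx; simpl in hx;
      unfold AbsRing_ball, abs, minus, plus, opp in hx; simpl in hx;
      apply Rabs_def2 in hx; lra.
  - apply filterlim_const.
  - apply F1_right_continuous; assumption. }
apply gap_lt0_of_F1; try assumption; try lra.
- intros y hy; destruct (Req_dec y v) as [-> | hyv]; [apply Rle_refl |].
  destruct (Req_dec y b) as [-> | hyb]; [apply hFb; lra |].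
  apply Rlt_le, hF; lra.
- destruct (Req_dec v b) as [-> | hvb]; [| apply hF; lra].
  (* At [v = b] the limit gives only a weak inequality; an intermediate point [y] restores
     strictness. *)
  assert (hm : exists y, b < y < b' /\ y < z).
  { exists (Rmin ((b + b') / 2) ((b + z) / 2)).
    assert (h1 := Rmin_l ((b + b') / 2) ((b + z) / 2)).
    assert (h2 := Rmin_r ((b + b') / 2) ((b + z) / 2)).
    assert (b < Rmin ((b + b') / 2) ((b + z) / 2)) by (apply Rmin_glb_lt; lra).
    lra. }
  destruct hm as [y [hy hyz]].
  apply Rlt_le_trans with (F1 mu sigma q g y); [apply hF; assumption | apply hFb, hy].
Qed.

(** * Regularity of the gap, its behaviour at infinity and the stability of its sign in [v] *)

Lemma ex_derive_F2 mu sigma q g b v z : 0 < sigma -> 0 < q ->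
  ex_derive g z -> ex_derive (F2 mu sigma q g b v) z.
Proof.
intros hs hq hg; unfold F2.
assert (hW : ex_derive (W mu sigma q) (z - v)) by (eexists; apply is_derive_W).
assert (hW' : ex_derive (W' mu sigma q) (z - v)) by (eexists; apply is_derive_W').
auto_derive; repeat split; auto.
apply Rgt_not_eq, W'_pos; assumption.
Qed.

Lemma continuous_gapA mu sigma q g b v : 0 <= b -> 0 < v ->
  (forall x, 0 < x -> ex_derive g x) ->
  filterlim g (at_right 0) (locally (g 0)) ->
  continuous (gapA mu sigma q g b) v.
Proof.
intros hb hv hg h0; apply (ex_derive_continuous (gapA mu sigma q g b)).
assert (hH : ex_derive (H mu sigma q g b) v).
{ eexists; apply is_derive_H; try assumption.
  intros x hx; apply (ex_derive_continuous g), hg, hx. }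
assert (hgv := hg v hv).
unfold gapA; auto_derive; auto.
Qed.

Lemma continuous_gapB mu sigma q g b v : 0 <= b -> 0 < v ->
  (forall x, 0 < x -> ex_derive g x) ->
  filterlim g (at_right 0) (locally (g 0)) ->
  continuous (gapB mu sigma q g b) v.
Proof.
intros hb hv hg h0; apply (ex_derive_continuous (gapB mu sigma q g b)).
assert (hH : ex_derive (H mu sigma q g b) v).
{ eexists; apply is_derive_H; try assumption.
  intros x hx; apply (ex_derive_continuous g), hg, hx. }
assert (hgv := hg v hv).
unfold gapB; auto_derive; auto.
Qed.

(** Serves to make the limit [- gapA] of the scaled gap at infinity strictly negative. *)
Lemma gapA_pos mu sigma q g b v : 0 < sigma -> 0 < q -> 0 <= b <= v -> 0 < v ->
  (forall x, 0 < x -> 0 < g x) ->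
  (forall x, 0 < x -> continuous g x) ->
  filterlim g (at_right 0) (locally (g 0)) ->
  0 < gapA mu sigma q g b v.
Proof.
intros hs hq hb hv hp hc h0.
apply Rmult_lt_0_compat; [| apply Rinv_0_lt_compat, sdisc_pos; assumption].
apply Rmult_lt_0_compat; [apply exp_pos |].
apply Rplus_le_lt_0_compat.
- apply Rmult_le_pos; [lra | apply H_ge0; assumption].
- apply Rmult_lt_0_compat; [| apply Phi_pos; assumption].
  apply Rmult_lt_0_compat; [| apply hp, hv].
  assert (0 < sigma ^ 2) by (apply pow_lt; lra); lra.
Qed.

Lemma gap_lt0_scaled mu sigma q g b v z : 0 < sigma -> 0 < q ->
  gap mu sigma q g b v z < 0 <-> scaled_gap mu sigma q g b v z < 0.
Proof.
intros hs hq; rewrite gap_exp by assumption.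
assert (h := exp_pos (Phi mu sigma q * z)); split; intros hn; nra.
Qed.

Lemma continuous_scaled_gap mu sigma q g b v z : continuous g z ->
  continuous (scaled_gap mu sigma q g b v) z.
Proof.
intros hg; unfold scaled_gap, Rminus.
apply (continuous_plus (V := R_NormedModule)).
- apply (continuous_plus (V := R_NormedModule)); [| apply continuous_const].
  apply (continuous_mult (K := R_AbsRing) g); [exact hg |].
  apply (ex_derive_continuous (fun x => / exp (Phi mu sigma q * x))).
  auto_derive; apply Rgt_not_eq, exp_pos.
- apply (ex_derive_continuous (fun z => - (gapB mu sigma q g b v
    * exp (- ((Phi mu sigma q + zeta1 mu sigma q) * z))))).
  auto_derive; trivial.
Qed.

Lemma is_lim_exp_decay k : 0 < k -> is_lim (fun z => exp (- (k * z))) p_infty 0.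
Proof.
intros hk; apply (is_lim_comp exp (fun z => - (k * z)) p_infty 0 m_infty).
- apply is_lim_exp_m.
- apply is_lim_spec; intros M; exists (- M / k); intros x hx.
  assert (- M < x * k); [| lra].
  apply (Rmult_lt_compat_r k) in hx; [| exact hk].
  unfold Rdiv in hx; rewrite Rmult_assoc, Rinv_l in hx by lra; lra.
- exists 0; intros y _; discriminate.
Qed.

(** The growth condition on [g] removes the first term and the decaying exponential the last one. *)
Lemma is_lim_scaled_gap mu sigma q g b v : 0 < sigma -> 0 < q ->
  is_lim (fun z => g z / exp (Phi mu sigma q * z)) p_infty 0 ->
  is_lim (scaled_gap mu sigma q g b v) p_infty (- gapA mu sigma q g b v).
Proof.
intros hs hq hg.
replace (- gapA mu sigma q g b v)
  with (0 - gapA mu sigma q g b v - gapB mu sigma q g b v * 0) by ring.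
apply is_lim_minus'; [apply is_lim_minus'; [exact hg | apply is_lim_const] |].
apply (is_lim_scal_l (fun z => exp (- ((Phi mu sigma q + zeta1 mu sigma q) * z)))
  (gapB mu sigma q g b v) p_infty 0).
apply is_lim_exp_decay.
assert (h1 := Phi_pos mu sigma q hs hq); assert (h2 := zeta1_pos mu sigma q hs hq); lra.
Qed.

Lemma eventually_lt0 (f : R -> R) (l : R) : is_lim f p_infty l -> l < 0 ->
  exists Z, forall z, Z < z -> f z < l / 2.
Proof.
intros hf hl; apply is_lim_spec in hf.
destruct (hf (mkposreal (- l / 2) ltac:(lra))) as [Z hZ]; simpl in hZ.
exists Z; intros z hz; apply hZ, Rabs_def2 in hz; lra.
Qed.

Lemma gap_eventually_lt0 mu sigma q g b v : 0 < sigma -> 0 < q -> 0 <= b <= v -> 0 < v ->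
  (forall x, 0 < x -> 0 < g x) ->
  (forall x, 0 < x -> continuous g x) ->
  filterlim g (at_right 0) (locally (g 0)) ->
  is_lim (fun z => g z / exp (Phi mu sigma q * z)) p_infty 0 ->
  exists Z, forall z, Z < z -> gap mu sigma q g b v z < 0.
Proof.
intros hs hq hb hv hp hc h0 hoo.
assert (hA := gapA_pos mu sigma q g b v hs hq hb hv hp hc h0).
destruct (eventually_lt0 _ _ (is_lim_scaled_gap mu sigma q g b v hs hq hoo)) as [Z hZ].
- lra.
- exists Z; intros z hz; apply gap_lt0_scaled; try assumption.
  apply hZ in hz; lra.
Qed.

(** On a compact interval the maximum of [f] is attained and negative; beyond it the limit keeps [f]
    below [l / 2]. *)
Lemma bounded_away_from_0 (f : R -> R) (d l : R) :
  (forall z, d <= z -> continuous f z) -> is_lim f p_infty l -> l < 0 ->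
  (forall z, d <= z -> f z < 0) ->
  exists m, 0 < m /\ forall z, d <= z -> f z <= - m.
Proof.
intros hc hf hl hn.
destruct (eventually_lt0 f l hf hl) as [Z hZ].
destruct (continuity_ab_maj f d (Rmax d Z)) as [x [hx hdx]].
- apply Rmax_l.
- intros c hcc; apply continuity_pt_filterlim, hc; lra.
- assert (hfx : f x < 0) by (apply hn; lra).
  exists (Rmin (- f x) (- l / 2)); split; [apply Rmin_glb_lt; lra |].
  intros z hz; destruct (Rle_lt_dec z (Rmax d Z)) as [h | h].
  + assert (h1 := Rmin_l (- f x) (- l / 2)).
    assert (h2 := hx z (conj hz h)); lra.
  + assert (h1 := Rmin_r (- f x) (- l / 2)).
    assert (h2 := Rmax_r d Z); assert (h3 := hZ z ltac:(lra)); lra.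
Qed.

Lemma continuous_close (f : R -> R) x eps : continuous f x -> 0 < eps ->
  exists d, 0 < d /\ forall y, Rabs (y - x) < d -> Rabs (f y - f x) < eps.
Proof.
intros hf he.
destruct (hf (fun t => Rabs (t - f x) < eps)) as [d hd].
{ exists (mkposreal eps he); intros t ht; exact ht. }
exists d; split; [apply cond_pos |].
intros y hy; exact (hd y hy).
Qed.

(* The gap depends on v only through the coefficients of two bounded
   exponentials, so no compactness in z is needed. *)
Lemma gap_lt0_near mu sigma q g b v d : 0 < sigma -> 0 < q ->
  0 <= b <= v -> 0 < v < d ->
  (forall x, 0 < x -> 0 < g x) ->
  (forall x, 0 < x -> ex_derive g x) ->
  filterlim g (at_right 0) (locally (g 0)) ->
  is_lim (fun z => g z / exp (Phi mu sigma q * z)) p_infty 0 ->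
  (forall z, d <= z -> gap mu sigma q g b v z < 0) ->
  exists r, 0 < r /\
    forall w z, Rabs (w - v) < r -> d <= z -> gap mu sigma q g b w z < 0.
Proof.
intros hs hq hb hv hp hg h0 hoo hn.
assert (hc : forall x, 0 < x -> continuous g x).
{ intros x hx; apply (ex_derive_continuous g), hg, hx. }
destruct (bounded_away_from_0 (scaled_gap mu sigma q g b v) d (- gapA mu sigma q g b v))
  as [m [hm hbd]].
- intros z hz; apply continuous_scaled_gap, hc; lra.
- apply is_lim_scaled_gap; assumption.
- assert (h := gapA_pos mu sigma q g b v hs hq hb (proj1 hv) hp hc h0); lra.
- intros z hz; apply gap_lt0_scaled; auto.
(* Each coefficient may use half of the margin [m]: [gapB] is multiplied by an exponential below 1,
   as [z > 0], so the total change is less than [m]. *)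
- destruct (continuous_close (gapA mu sigma q g b) v (m / 2)) as [dA [hdA hA]].
  { apply continuous_gapA; try assumption; lra. }
  { lra. }
  destruct (continuous_close (gapB mu sigma q g b) v (m / 2)) as [dB [hdB hB]].
  { apply continuous_gapB; try assumption; lra. }
  { lra. }
  exists (Rmin dA dB); split; [apply Rmin_glb_lt; assumption |].
  intros w z hw hz; apply gap_lt0_scaled; try assumption.
  assert (h1 := Rmin_l dA dB); assert (h2 := Rmin_r dA dB).
  specialize (hA w ltac:(lra)); specialize (hB w ltac:(lra)); specialize (hbd z hz).
  unfold scaled_gap in *.
  assert (hP := Phi_pos mu sigma q hs hq); assert (hZ := zeta1_pos mu sigma q hs hq).
  set (e := exp (- ((Phi mu sigma q + zeta1 mu sigma q) * z))) in *.
  assert (he0 : 0 < e) by apply exp_pos.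
  assert (he1 : e < 1).
  { unfold e; rewrite <- exp_0; apply exp_increasing.
    assert (0 < (Phi mu sigma q + zeta1 mu sigma q) * z); [| lra].
    apply Rmult_lt_0_compat; lra. }
  apply Rabs_def2 in hA; apply Rabs_def2 in hB; nra.
Qed.

Lemma gap_gt0_near mu sigma q g b v z : 0 < sigma -> 0 < q -> 0 <= b -> 0 < v ->
  (forall x, 0 < x -> ex_derive g x) ->
  filterlim g (at_right 0) (locally (g 0)) ->
  0 < gap mu sigma q g b v z ->
  exists r, 0 < r /\ forall w, Rabs (w - v) < r -> 0 < gap mu sigma q g b w z.
Proof.
intros hs hq hb hv hg h0 hpos.
destruct (continuous_close (fun w => gap mu sigma q g b w z) v
  (gap mu sigma q g b v z)) as [d [hd hclose]].
- apply (ex_derive_continuous (fun w => gap mu sigma q g b w z)).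
  eexists; apply is_derive_gap; assumption.
- exact hpos.
- exists d; split; [exact hd |]; intros w hw.
  specialize (hclose w hw); simpl in hclose; apply Rabs_def2 in hclose; lra.
Qed.

(** * Largest maximisers and membership in [D1] *)

(** For the function [F2 v] and [a = v] this is, by conversion, the set whose supremum defines
    [z1]. *)
Definition argmax_from (f : R -> R) (a y : R) : Prop :=
  a <= y /\ forall z, a <= z -> f y >= f z.

(** Values beyond [Z] are below [f a], so a maximum over [[a, Rmax a Z]] is global and all
    maximisers lie there. By continuity they form a closed set, which contains its supremum. *)
Lemma Lub_argmax_from (f : R -> R) (a Z : R) :
  (forall x, a <= x -> continuous f x) ->
  (forall z, Z < z -> f z < f a) ->
  exists m, Lub_Rbar (argmax_from f a) = Finite m /\ argmax_from f a m.
Proof.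
intros hc hZ.
destruct (continuity_ab_maj f a (Rmax a Z)) as [x [hx hax]].
{ apply Rmax_l. }
{ intros c hcc; apply continuity_pt_filterlim, hc; lra. }
assert (hxm : argmax_from f a x).
{ split; [lra |]; intros z hz.
  destruct (Rle_lt_dec z (Rmax a Z)) as [h | h]; [apply Rle_ge, hx; lra |].
  assert (h1 := Rmax_l a Z); assert (h2 := Rmax_r a Z).
  assert (h3 := hZ z ltac:(lra)); assert (h4 := hx a ltac:(lra)); lra. }
destruct (Lub_Rbar_correct (argmax_from f a)) as [hub hlub].
assert (hle : Rbar_le (Lub_Rbar (argmax_from f a)) (Rmax a Z)).
{ apply hlub; intros y [hy hymax]; simpl; apply Rnot_lt_le; intros hn.
  assert (h2 := Rmax_r a Z).
  assert (h3 := hZ y ltac:(lra)); assert (h4 := hymax a (Rle_refl a)); lra. }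
assert (hge : Rbar_le x (Lub_Rbar (argmax_from f a))) by exact (hub x hxm).
destruct (Lub_Rbar (argmax_from f a)) as [m | |]; [| contradiction | contradiction].
exists m; split; [reflexivity |]; simpl in hge.
split; [lra |]; intros z hz; apply Rle_ge, Rnot_lt_le; intros hlt.
(* If [f m < f z], no maximiser lies within [d] of [m], and [m - d] would be a smaller upper
   bound. *)
destruct (continuous_close f m (f z - f m)) as [d [hd hclose]].
{ apply hc; lra. }
{ lra. }
assert (hmd : Rbar_le m (m - d)).
{ apply hlub; intros y hy; simpl; apply Rnot_lt_le; intros hn.
  assert (hym : y <= m) by exact (hub y hy).
  specialize (hclose y ltac:(apply Rabs_def1; lra)); apply Rabs_def2 in hclose.
  destruct hy as [_ hy]; specialize (hy z hz); lra. }
simpl in hmd; lra.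
Qed.

Lemma z1_argmax mu sigma q g b v : 0 < sigma -> 0 < q -> 0 <= b <= v -> 0 < v ->
  (forall x, 0 < x -> 0 < g x) ->
  (forall x, 0 < x -> ex_derive g x) ->
  filterlim g (at_right 0) (locally (g 0)) ->
  is_lim (fun z => g z / exp (Phi mu sigma q * z)) p_infty 0 ->
  exists m, z1 mu sigma q g b v = Finite m /\ argmax_from (F2 mu sigma q g b v) v m.
Proof.
intros hs hq hb hv hp hg h0 hoo.
assert (hc : forall x, 0 < x -> continuous g x).
{ intros x hx; apply (ex_derive_continuous g), hg, hx. }
destruct (gap_eventually_lt0 mu sigma q g b v) as [Z hZ]; try assumption.
apply (Lub_argmax_from (F2 mu sigma q g b v) v Z).
- intros x hx; apply (ex_derive_continuous (F2 mu sigma q g b v)), ex_derive_F2; try assumption.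
  apply hg; lra.
- intros z hz; apply Rnot_le_lt; intros hn; apply Rle_ge, F2_ge_diag in hn; try assumption.
  specialize (hZ z hz); lra.
Qed.

(** If the gap were negative at every [z > v], no maximiser would lie to the right of [v], and [z1]
    could not exceed [v]. *)
Lemma D1_gap mu sigma q g b c v : 0 < sigma -> 0 < q ->
  D1 mu sigma q g b c v ->
  exists z, v < z /\ 0 <= gap mu sigma q g b v z.
Proof.
intros hs hq [_ hz1].
destruct (Lub_Rbar_correct (argmax_from (F2 mu sigma q g b v) v)) as [_ hlub].
apply NNPP; intros hno.
apply (Rbar_lt_not_le _ _ hz1), hlub.
intros y [hy hymax]; simpl; apply Rnot_lt_le; intros hn; apply hno; exists y.
split; [exact hn |].
apply F2_ge_diag; [assumption | assumption |]; apply hymax, Rle_refl.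
Qed.

(** A tie with the diagonal suffices because [z1] is the largest maximiser: if it were [v], then [z]
    would be a maximiser too, and a larger one. *)
Lemma gap_lt_z1 mu sigma q g b v z : 0 < sigma -> 0 < q -> 0 <= b <= v -> 0 < v ->
  (forall x, 0 < x -> 0 < g x) ->
  (forall x, 0 < x -> ex_derive g x) ->
  filterlim g (at_right 0) (locally (g 0)) ->
  is_lim (fun z => g z / exp (Phi mu sigma q * z)) p_infty 0 ->
  v < z -> 0 <= gap mu sigma q g b v z ->
  Rbar_lt v (z1 mu sigma q g b v).
Proof.
intros hs hq hb hv hp hg h0 hoo hvz hgap.
destruct (z1_argmax mu sigma q g b v) as [m [hm [hvm hmax]]]; try assumption.
destruct (Lub_Rbar_correct (argmax_from (F2 mu sigma q g b v) v)) as [hub _].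
destruct (Req_dec m v) as [hmv | hmv]; [| rewrite hm; simpl; lra].
apply F2_ge_diag in hgap; try assumption.
rewrite hmv in hmax.
apply Rbar_lt_le_trans with z; [exact hvz |].
apply hub; split; [lra |]; intros y hy.
apply Rge_trans with (F2 mu sigma q g b v v); [exact hgap | apply hmax, hy].
Qed.

(** * Location of [b1star], [b2star] and [b3star] *)

Lemma b1star_ge0 mu sigma q g : 0 <= b1star mu sigma q g.
Proof.
unfold b1star.
match goal with |- context [Lub_Rbar ?E] =>
  destruct (Lub_Rbar_correct E) as [hub hlub]; destruct (Lub_Rbar E) as [m | |]
end; simpl; [| apply Rle_refl | apply Rle_refl].
(* Infinite suprema are sent to 0 by [real]. A finite negative one would force the set of
   nonnegative maximisers to be empty, so that [m_infty] would be an upper bound. *)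
apply Rnot_lt_le; intros hm.
assert (h : Rbar_le m m_infty); [| exact h].
apply hlub; intros u [hu hmax].
assert (hum : u <= m) by exact (hub u (conj hu hmax)); lra.
Qed.

Theorem theorem4p1 (mu sigma q : R) (g : R -> R) (b1 b11 c1 b2 b3 : R)
  (hsigma : 0 < sigma) (hq : 0 < q)
  (g_pos : forall x, 0 < x -> 0 < g x)
  (g_d1 : forall x, 0 < x -> ex_derive g x)
  (g_d2 : forall x, 0 < x -> ex_derive_n g 2 x)
  (g_c2 : forall x, 0 < x -> continuous (Derive_n g 2) x)
  (g_0 : filterlim g (at_right 0) (locally (g 0)))
  (g_oo : is_lim (fun z => g z / exp (Phi mu sigma q * z)) p_infty 0)
  (hb1 : b1 = b1star mu sigma q g)
  (hb11 : b1 < b11)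
  (hb11_F' : forall v, b1 < v < b11 -> Derive (F1 mu sigma q g) v < 0)
  (hb11_F : forall v z, b1 < v < b11 -> v < z ->
    F1 mu sigma q g v > F1 mu sigma q g z)
  (hc1 : is_min (P1 mu sigma q g b1 b11) c1)
  (hv1 : exists v1, b1 < v1 /\ LqH mu sigma q g b1 v1 > 0)
  (hb2 : b2 = b2star mu sigma q g b1 c1)
  (hb3 : b3 = b3star mu sigma q g b1 c1)
  (heps1 : exists eps1, 0 < eps1 /\
    forall v, b2 < v < b2 + eps1 -> LqH mu sigma q g b1 v < 0) :
  b1 < b2 < b3 /\
  b2 < c1 /\
  F2 mu sigma q g b1 b2 b2 = F2 mu sigma q g b1 b2 b3.
Proof.
assert (g_c : forall x, 0 < x -> continuous g x).
{ intros x hx; apply (ex_derive_continuous g), g_d1, hx. }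
assert (hb1_0 : 0 <= b1) by (rewrite hb1; apply b1star_ge0).
destruct hc1 as [[hb11c1 [eps [heps [_ [_ hLpos]]]]] _].
assert (hD1 : forall v z, b1 <= v <= c1 -> 0 < v -> v < z ->
  0 <= gap mu sigma q g b1 v z -> D1 mu sigma q g b1 c1 v).
{ intros v z hv hv0 hvz hgap; split; [exact hv |].
  apply (gap_lt_z1 mu sigma q g b1 v z); try assumption; lra. }
assert (hD1_ge : forall v, D1 mu sigma q g b1 c1 v -> b11 <= v).
{ intros v hv; apply Rnot_lt_le; intros hlt.
  destruct (D1_gap mu sigma q g b1 c1 v hsigma hq hv) as [z [hvz hgap]].
  destruct hv as [hv _].
  assert (h : gap mu sigma q g b1 v z < 0); [| lra].
  apply (gap_lt0_initial mu sigma q g b1 b11); try assumption; lra. }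
assert (hw : exists w, b11 < w < c1 /\ D1 mu sigma q g b1 c1 w).
{ assert (hz : 0 < gap mu sigma q g b1 c1 (c1 + eps / 2)).
  { destruct (gap_mean_value mu sigma q g b1 c1 (c1 + eps / 2)) as [y [k [hy [hk ->]]]];
      try assumption; try lra.
    apply Rmult_lt_0_compat; [exact hk | apply hLpos; lra]. }
  destruct (gap_gt0_near mu sigma q g b1 c1 (c1 + eps / 2)) as [r [hr hnear]];
    try assumption; try lra.
  (* The maximum keeps [w] above [b11] and at the same time within [r] of [c1]. *)
  set (w := Rmax ((b11 + c1) / 2) (c1 - r / 2)).
  assert (h1 : (b11 + c1) / 2 <= w) by apply Rmax_l.
  assert (h2 : c1 - r / 2 <= w) by apply Rmax_r.
  assert (h3 : w < c1) by (apply Rmax_lub_lt; lra).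
  exists w; split; [lra |].
  apply (hD1 w (c1 + eps / 2)); try lra.
  apply Rlt_le, hnear, Rabs_def1; lra. }
destruct hw as [w [hw hwD]].
(* The infimum lies between [b11] and [w], hence is finite, and [real] returns its true value. *)
assert (hglb : is_glb_Rbar (D1 mu sigma q g b1 c1) b2).
{ assert (h := Glb_Rbar_correct (D1 mu sigma q g b1 c1)).
  rewrite hb2; unfold b2star; destruct h as [hlb hgl].
  assert (hle : Rbar_le (Glb_Rbar (D1 mu sigma q g b1 c1)) w) by exact (hlb w hwD).
  assert (hge : Rbar_le b11 (Glb_Rbar (D1 mu sigma q g b1 c1))).
  { apply hgl; intros v hv; exact (hD1_ge v hv). }
  destruct (Glb_Rbar (D1 mu sigma q g b1 c1)) as [m | |]; try contradiction.
  split; assumption. }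
destruct hglb as [hlb hgl].
assert (hb2w : b2 <= w) by exact (hlb w hwD).
assert (hb2b11 : b11 <= b2) by exact (hgl b11 hD1_ge).
assert (hz : exists z, b2 < z /\ 0 <= gap mu sigma q g b1 b2 z).
{ apply NNPP; intros hno; destruct heps1 as [e [he hLneg]].
  destruct (gap_lt0_near mu sigma q g b1 b2 (b2 + e / 2)) as [r [hr hnear]];
    try assumption; try lra.
  { intros z hz; apply Rnot_le_lt; intros hn; apply hno; exists z; split; [lra | exact hn]. }
  assert (hv : exists v, D1 mu sigma q g b1 c1 v /\ v < b2 + Rmin r (e / 2)).
  { apply NNPP; intros hnv.
    assert (h : Rbar_le (b2 + Rmin r (e / 2)) b2).
    { apply hgl; intros v hv; simpl; apply Rnot_lt_le; intros hlt.
      apply hnv; exists v; split; assumption. }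
    assert (0 < Rmin r (e / 2)) by (apply Rmin_glb_lt; lra).
    simpl in h; lra. }
  destruct hv as [v [hvD hv]].
  assert (h1 := Rmin_l r (e / 2)); assert (h2 := Rmin_r r (e / 2)).
  assert (hb2v : b2 <= v) by exact (hlb v hvD).
  destruct (D1_gap mu sigma q g b1 c1 v hsigma hq hvD) as [z [hvz hgap]].
  (* A witness beyond [b2 + e / 2] contradicts the bound uniform in [z]; for a closer one, [(v, z)]
     lies where [(L - q)H < 0]. *)
  destruct (Rle_lt_dec (b2 + e / 2) z) as [hd | hd].
  - assert (h : gap mu sigma q g b1 v z < 0); [| lra].
    apply hnear; [apply Rabs_def1; lra | exact hd].
  - destruct (gap_mean_value mu sigma q g b1 v z) as [y [k [hy [hk heq]]]];
      try assumption; try lra.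
    assert (hL := hLneg y ltac:(lra)); nra. }
destruct hz as [z [hb2z hgap]].
assert (hlt : Rbar_lt b2 (z1 mu sigma q g b1 b2)).
{ apply (gap_lt_z1 mu sigma q g b1 b2 z); try assumption; lra. }
destruct (z1_argmax mu sigma q g b1 b2) as [m [hm [_ hmax]]]; try assumption; try lra.
assert (hb3m : b3 = m) by (rewrite hb3; unfold b3star; rewrite <- hb2, hm; reflexivity).
rewrite hm in hlt; simpl in hlt; rewrite hb3m.
split; [lra | split; [lra |]].
assert (hgm := hmax b2 (Rle_refl b2)).
apply F2_ge_diag in hgm; try assumption.
destruct hgm as [hpos | h0].
- destruct (gap_gt0_near mu sigma q g b1 b2 m) as [r [hr hnear]]; try assumption; try lra.
  (* A point left of [b2], above [b1] as [D1] demands, and close enough to [b2] for the gap at [m]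
     to remain positive. *)
  set (v := Rmax ((b1 + b2) / 2) (b2 - r / 2)).
  assert (h1 : (b1 + b2) / 2 <= v) by apply Rmax_l.
  assert (h2 : b2 - r / 2 <= v) by apply Rmax_r.
  assert (h3 : v < b2) by (apply Rmax_lub_lt; lra).
  assert (hvD : D1 mu sigma q g b1 c1 v).
  { apply (hD1 v m); try lra.
    apply Rlt_le, hnear, Rabs_def1; lra. }
  assert (hb2v : b2 <= v) by exact (hlb v hvD); lra.
- rewrite (F2_gap mu sigma q g b1 b2 m), <- h0 by assumption.
  unfold Rdiv; ring.
Qed.
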